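(* For every $n\ge 1$, every 2D word of size $(2,n)$ (over any finite alphabet) has at most $2n$ distinct non-empty HV-palindromic factors, and there exists a 2D word of size $(2,n)$ with exactly $2n$ distinct non-empty HV-palindromic factors. That is, the maximum number of HV-palindromes in a 2D word of size $(2,n)$ is $2n$.
   Context: A 2D word of size $(m,n)$ over a finite alphabet $\Sigma$ is an $m\times n$ array $w=[w_{i,j}]$ with entries in $\Sigma$; its rows and columns are 1D words. A factor of $w$ is a sub-array $[w_{i,j}]_{a\le i\le b,\,c\le j\le d}$ with $1\le a\le b\le m$, $1\le c\le d\le n$; factors are counted as distinct arrays, independently of their positions. A 1D word is a palindrome if it equals its reversal, and a 2D word is an HV-palindrome if each of its rows and each of its columns is a 1D palindrome. *)

(* Defs.v *)
From mathcomp Require Import all_boot all_order all_algebra.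

Set Implicit Arguments.
Unset Strict Implicit.
Unset Printing Implicit Defensive.

Definition word2 (T : Type) (m n : nat) : Type := 'M[T]_(m, n).

(* Words of different sizes are gathered in one type, where equality means
   equality of the sizes and of all the entries. *)
Definition array (T : eqType) : eqType :=
  {s : nat * nat & 'M[T]_(s.1, s.2)}.

Definition mk_array (T : eqType) (p q : nat) (u : word2 T p q) : array T :=
  Tagged (fun s : nat * nat => 'M[T]_(s.1, s.2)) (i := (p, q)) u.

Definition palindrome (T : eqType) (s : seq T) : bool := rev s == s.

Definition word_row (T : eqType) (p q : nat) (u : word2 T p q) (i : 'I_p) :
  seq T := [seq u i j | j : 'I_q].

Definition word_col (T : eqType) (p q : nat) (u : word2 T p q) (j : 'I_q) :
  seq T := [seq u i j | i : 'I_p].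

Definition HV_palindrome (T : eqType) (u : array T) : bool :=
  [forall i, palindrome (word_row (tagged u) i)] &&
  [forall j, palindrome (word_col (tagged u) j)].

(* The sub-array of [w] on the rows a..b and the columns c..d, for a <= b and
   c <= d. Under these conditions a + i <= b and c + j <= d, so the default
   values of [insubd] are never used. *)
Definition subarray (T : eqType) (m n : nat) (w : word2 T m n)
    (a b : 'I_m) (c d : 'I_n) : array T :=
  mk_array (\matrix_(i < ((b - a).+1)%N, j < ((d - c).+1)%N)
              w (insubd b (a + i)%N) (insubd d (c + j)%N))%R.

(* Every factor has at least one row and one column, hence is non-empty. *)
Definition factors (T : eqType) (m n : nat) (w : word2 T m n) :
  seq (array T) :=
  undup [seq subarray w r.1 r.2 s.1 s.2
        | r <- [seq r : 'I_m * 'I_m <- enum {: 'I_m * 'I_m} | r.1 <= r.2],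
          s <- [seq s : 'I_n * 'I_n <- enum {: 'I_n * 'I_n} | s.1 <= s.2]].

Definition nb_HV_palindromes (T : eqType) (m n : nat) (w : word2 T m n) : nat :=
  count (@HV_palindrome T) (factors w).

(* Main.v *)
(* A one-row palindromic factor is a palindrome occurring in one of the two
   rows.  A two-row HV-palindromic factor has equal rows, hence is determined by
   a palindrome occurring in both rows.  If A and B are the sets of non-empty
   palindromes of the two rows, the number of HV-palindromes is therefore at
   most |A U B| + |A n B| = |A| + |B|, and |A|, |B| <= n because a word of
   length n has at most n non-empty palindromic factors.  The bound is reached
   by the constant word. *)
Require Import Defs.
From mathcomp Require Import all_boot all_order all_algebra zify.

(** The prefix [u] of the palindrome [v] is, by reversal, also a suffix of [v]. Being strictly
    shorter, this second occurrence avoids the first letter of [v], hence lies in [t]. *)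
Lemma palindromic_prefix_infix_tail {T : eqType} (x : T) (t u v : seq T) :
  palindrome u -> palindrome v -> prefix u (x :: t) -> prefix v (x :: t) ->
  size u < size v -> infix u t.
Proof.
move=> /eqP pu /eqP pv upre vpre lt_uv.
have pre_uv : prefix u v.
  move: upre vpre; rewrite !prefixE => upre /eqP <-.
  by rewrite take_takel // ltnW.
have suf_uv : suffix u v by rewrite -pu -pv suffix_rev.
case: v {pv pre_uv} vpre lt_uv suf_uv => [//|y v] /=.
case: eqP => //= _ vpre lt_uv /suffixP[[|z p] e].
  by move: lt_uv; rewrite -/(size (y :: v)) e ltnn.
case: e => _ e; apply: infix_trans (prefixW vpre).
by rewrite e; apply/suffixW/suffix_suffix.
Qed.

(* Among the palindromes, only the longest one starting at the first letter may
   fail to occur later, so each letter contributes at most one palindrome. *)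
Lemma size_palindromic_factors {T : eqType} (s : seq T) (L : seq (seq T)) :
  uniq L ->
  (forall u, u \in L -> [/\ palindrome u, u != [::] & infix u s]) ->
  size L <= size s.
Proof.
elim: s L => [|x t IHt] L uL HL.
  case: L uL HL => //= u L _ /(_ u (mem_head _ _))[_ u0].
  by rewrite (negPf u0).
rewrite -(count_predC (fun u => infix u t)) /= -addn1 leq_add //.
  rewrite -size_filter; apply: IHt => [|u]; first exact: filter_uniq.
  by rewrite mem_filter => /andP[ut /HL[]].
rewrite -size_filter; set M := filter _ _.
have uM : uniq M by exact: filter_uniq.
have HM u : u \in M -> [/\ palindrome u, prefix u (x :: t) & ~~ infix u t].
  rewrite mem_filter /= => /andP[nut /HL[pu _]].
  by rewrite infix_consl (negPf nut) orbF.
case: M uM HM => [|u [|v M]] // /andP[+ _] HM.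
have [pu upre nu] := HM u (mem_head _ _).
have [pv vpre nv] : [/\ palindrome v, prefix v (x :: t) & ~~ infix v t].
  by apply: HM; rewrite !inE eqxx orbT.
case: (ltngtP (size u) (size v)) => [lt_uv|lt_vu|eq_uv].
- by rewrite (palindromic_prefix_infix_tail _ _ _ _ pu pv upre vpre) in nu.
- by rewrite (palindromic_prefix_infix_tail _ _ _ _ pv pu vpre upre) in nv.
- suff -> : u = v by rewrite mem_head.
  by move: upre vpre; rewrite !prefixE eq_uv => /eqP <- /eqP.
Qed.

(** An inverse of taking the common row: it shows that an array with equal rows is determined by its
    height and that row. *)
Definition row_array {T : eqType} (p : nat) (s : seq T) : array T :=
  mk_array (\matrix_(i < p, j < size s) tnth (in_tuple s) j)%R.

Lemma row_arrayE {T : eqType} {p q : nat} (M : word2 T p q) (i : 'I_p) :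
  (forall i' j, M i' j = M i j) -> mk_array M = row_array p (word_row M i).
Proof.
move=> eqM; have: forall i' j, M i' j = nth (M i' j) (word_row M i) j.
  move=> i' j; rewrite (nth_map j) ?size_enum_ord ?nth_ord_enum //; exact: eqM.
have: q = size (word_row M i) by rewrite size_map size_enum_ord.
(* Once the row is generalized to [s], the width [q] can be replaced by [size s], so no cast between
   matrix types is needed. *)
rewrite /row_array; move: (word_row M i) => s eq_q; subst q => {}eqM.
congr mk_array; apply/matrixP => i' j; rewrite mxE eqM (tnth_nth (M i' j)) //.
Qed.

Lemma eq_rows_of_palindromic_cols {T : eqType} {p q : nat} (M : word2 T p q) :
  p <= 2 -> [forall j, palindrome (word_col M j)] ->
  forall i i' j, M i j = M i' j.
Proof.
move=> p2 /forallP + i i' j => /(_ j).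
case: p p2 M i i' => [|[|[|//]]] _ M; first by case.
  by move=> i i'; rewrite !ord1.
have enum2 : enum 'I_2 = [:: ord0; ord_max].
  by apply: (inj_map val_inj); rewrite val_enum_ord.
rewrite /palindrome /word_col /image_mem enum2 => i i' /eqP[_ e].
suff eq0 k : M k j = M ord0 j by rewrite eq0 [RHS]eq0.
by case: k => [[|[|//]] h]; [|rewrite e]; congr (M _ j); apply: val_inj.
Qed.

Lemma subarray_row_infix {T : eqType} {m n : nat} (w : word2 T m n)
    (a b : 'I_m) (c d : 'I_n) (i : 'I_(b - a).+1) (k : 'I_m) :
  a <= b -> c <= d -> k = a + i :> nat ->
  infix (word_row (tagged (subarray w a b c d)) i) (word_row w k).
Proof.
move=> le_ab le_cd eq_k.
suff -> : word_row (tagged (subarray w a b c d)) i =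
    take (d - c).+1 (drop c (word_row w k)).
  by apply: infix_trans (suffixW (suffix_drop _ _)); exact/prefixW/prefix_take.
have size_row : size (take (d - c).+1 (drop c (word_row w k))) = (d - c).+1.
  rewrite size_takel // size_drop size_map size_enum_ord.
  by have := ltn_ord d; lia.
apply: (@eq_from_nth _ (w k d)).
  by rewrite size_row size_map size_enum_ord.
move=> j; rewrite size_map size_enum_ord => lt_j.
rewrite nth_take // nth_drop (nth_map ord0) ?size_enum_ord //.
have lt_cj : c + j < n by have := ltn_ord d; move: lt_j => /=; lia.
rewrite (nth_map d) ?size_enum_ord // mxE.
(* Both indices are in range, so [insubd] never returns its default. *)
congr (w _ _); apply: val_inj; rewrite val_insubd.
  by rewrite -eq_k ltn_ord.
by rewrite /= !nth_enum_ord // lt_cj.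
Qed.

(** The choice of the row is harmless: it is applied to factors whose rows are all equal. The empty
    word is the value for arrays without rows. *)
Definition some_row {T : eqType} (x : array T) : seq T :=
  if [pick i : 'I_(tag x).1] is Some i then word_row (tagged x) i else [::].

Lemma HV_palindromic_factor_two_rows {T : eqType} {n : nat} (w : word2 T 2 n)
    (x : array T) :
  x \in factors w -> HV_palindrome x ->
  [/\ x = row_array (tag x).1 (some_row x),
      palindrome (some_row x), some_row x != [::] &
      if (tag x).1 == 1
      then infix (some_row x) (word_row w ord0)
           || infix (some_row x) (word_row w ord_max)
      else [&& (tag x).1 == 2, infix (some_row x) (word_row w ord0)
             & infix (some_row x) (word_row w ord_max)]].
Proof.
rewrite mem_undup => /allpairsP[[[a b] [c d]] /= []].
rewrite !mem_filter /= => /andP[le_ab _] /andP[le_cd _] ->.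
set x' := subarray w a b c d => /andP[/forallP row_pal col_pal].
have height : (b - a).+1 <= 2 by have := ltn_ord b; lia.
have eq_rows := eq_rows_of_palindromic_cols _ height col_pal.
rewrite /some_row; case: pickP => [i _|/(_ ord0)//].
have eq_row (i' : 'I_(b - a).+1) :
    word_row (tagged x') i = word_row (tagged x') i'.
  by apply: eq_map => j; apply: eq_rows.
split; [|exact: row_pal| |].
- by apply: row_arrayE => i' j; apply: eq_rows.
- by rewrite -size_eq0 size_map size_enum_ord.
have row_infix (k : 'I_2) : a <= k <= b ->
    infix (word_row (tagged x') i) (word_row w k).
  move=> /andP[le_ak le_kb].
  have lt_k : k - a < (b - a).+1 by lia.
  by rewrite (eq_row (Ordinal lt_k)); apply: subarray_row_infix => //=; lia.
have := ltn_ord a; have := ltn_ord b => lt_b lt_a.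
rewrite /= eqSS; case: eqP => [eq_ab|ne_ab].
  case: (posnP a) => a0; apply/orP; [left|right]; apply: row_infix => /=; lia.
by apply/and3P; split; [|apply: row_infix..] => /=; lia.
Qed.

Lemma nb_HV_palindromes_two_rows_le {T : eqType} {n : nat} (w : word2 T 2 n) :
  nb_HV_palindromes w <= 2 * n.
Proof.
rewrite /nb_HV_palindromes -size_filter; set F := filter _ _.
have uF : uniq F by rewrite filter_uniq ?undup_uniq.
have FP x : x \in F -> x \in factors w /\ HV_palindrome x.
  by rewrite mem_filter => /andP[].
clearbody F.
have size_row k : size (word_row w k) = n by rewrite size_map size_enum_ord.
pose one_row (x : array T) := (tag x).1 == 1.
pose in_top (x : array T) := infix (some_row x) (word_row w ord0).
(* With A and B the palindromes of the top and bottom rows, [some_row] sends [F1] into A, [F2] into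
   B minus A, and [F3] into the intersection of A and B. So [F1] is bounded through the top row, and
   [F2] and [F3] together through the bottom row. *)
pose F1 := [seq x <- F | one_row x && in_top x].
pose F2 := [seq x <- F | one_row x && ~~ in_top x].
pose F3 := [seq x <- F | ~~ one_row x].
have -> : size F = size F1 + (size F2 + size F3).
  rewrite !size_filter; elim: (F) => //= x s ->.
  by case: (one_row x); case: (in_top x) => /=; lia.
(* At a fixed height, [some_row] is injective on [F], since [row_array] recovers the factor. *)
have uniq_rows (P : pred (array T)) p :
    (forall x, x \in F -> P x -> (tag x).1 = p) ->
    uniq [seq some_row x | x <- F & P x].
  move=> hp; rewrite map_inj_in_uniq ?filter_uniq // => x y.
  rewrite !mem_filter => /andP[Px Fx] /andP[Py Fy] e.
  have [/HV_palindromic_factor_two_rows/[apply]-[-> _ _ _]] := FP x Fx.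
  have [/HV_palindromic_factor_two_rows/[apply]-[-> _ _ _]] := FP y Fy.
  by rewrite e (hp x) // (hp y).
rewrite mul2n -addnn leq_add //.
  rewrite -(size_map some_row) -[leqRHS](size_row ord0).
  apply: size_palindromic_factors => [|u /mapP[x]].
    by apply: (uniq_rows _ 1) => x _ /andP[/eqP].
  rewrite mem_filter => /andP[/andP[_ top] /FP[Fx HVx]] ->.
  by have [_ ? ? _] := HV_palindromic_factor_two_rows w x Fx HVx.
rewrite -size_cat -(size_map some_row) -[leqRHS](size_row ord_max).
apply: size_palindromic_factors => [|u /mapP[x]].
  have F3P x : x \in F3 -> (tag x).1 = 2 /\ in_top x.
    rewrite mem_filter => /andP[two /FP[Fx HVx]].
    have [_ _ _] := HV_palindromic_factor_two_rows w x Fx HVx.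
    by rewrite ifN // => /and3P[/eqP].
  rewrite map_cat cat_uniq; apply/and3P; split.
  - by apply: (uniq_rows _ 1) => x _ /andP[/eqP].
  (* Factors of different heights could share a row, but rows from [F3] occur in the top row and
     those from [F2] do not. *)
  - apply/hasPn => _ /mapP[y /F3P[_ topy] ->]; apply/mapP => -[x].
    rewrite mem_filter => /andP[/andP[_ /negP ntop] _] e.
    by rewrite /in_top -e in ntop.
  - apply: (uniq_rows _ 2) => x Fx two.
    by have [] := F3P x; rewrite ?mem_filter ?two.
rewrite mem_cat !mem_filter -!andb_orl => /andP[cond /FP[Fx HVx]] ->.
have [_ ? ? bottom] := HV_palindromic_factor_two_rows w x Fx HVx.
split=> //; move: cond bottom; rewrite /one_row /in_top.
by case: eqP => //= _; [rewrite orbF => /negPf -> | move=> _ /and3P[]].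
Qed.

Lemma palindrome_unit (s : seq unit) : palindrome s.
Proof.
apply/eqP/(@eq_from_nth _ tt); rewrite ?size_rev // => i _.
by case: (nth _ _ _); case: (nth _ _ _).
Qed.

(** The sub-arrays anchored at the top-left corner have pairwise distinct sizes, one for each
    position of the opposite corner, and over a single letter all of them are HV-palindromes. *)
Lemma nb_HV_palindromes_unit_ge {m n : nat} (w : word2 unit m n) :
  m * n <= nb_HV_palindromes w.
Proof.
case: m w => [//|m]; case: n => [|n] w; first by rewrite muln0.
rewrite /nb_HV_palindromes -size_filter.
pose A (r : 'I_m.+1 * 'I_n.+1) := subarray w ord0 r.1 ord0 r.2.
have -> : m.+1 * n.+1 = size (map A (enum {: 'I_m.+1 * 'I_n.+1})).
  by rewrite size_map -cardE card_prod !card_ord.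
apply: uniq_leq_size => [|_ /mapP[[i j] _ ->]].
  rewrite map_inj_uniq ?enum_uniq // => -[i j] [i' j'] /(congr1 tag) /= [].
  by rewrite !subn0 => /val_inj -> /val_inj ->.
rewrite mem_filter mem_undup; apply/andP; split.
  by apply/andP; split; apply/forallP => k; apply: palindrome_unit.
apply/allpairsP; exists ((ord0, i), (ord0, j)).
by split=> //; rewrite mem_filter mem_enum.
Qed.

Theorem theorem5p1 (n : nat) (hn : 1 <= n) :
  (forall (Sigma : finType) (w : word2 Sigma 2 n),
     nb_HV_palindromes w <= 2 * n) /\
  (exists (Sigma : finType) (w : word2 Sigma 2 n),
     nb_HV_palindromes w = 2 * n).
Proof.
split=> [Sigma w|]; first exact: nb_HV_palindromes_two_rows_le.
exists unit, (const_mx tt); apply/eqP; rewrite eqn_leq.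
by rewrite nb_HV_palindromes_two_rows_le nb_HV_palindromes_unit_ge.
Qed.
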